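(* Let $k$ be a fixed positive integer. There is a finite automaton $\mathrm{Aut}_k$ whose accepted language consists exactly of the insertion encodings of the permutations in $\mathcal{B}_k \cap \mathrm{Av}(4231)$. The states of $\mathrm{Aut}_k$ can be taken to be the lock sequences of length at most $k$, with the sequence $0$ of length one as initial state and only accepting state, and the transitions from a lock sequence $s$ are labelled by the codes of the allowed insertions at $s$, each leading from $s$ to the lock sequence resulting from that insertion (only those transitions whose resulting lock sequence has length at most $k$ being present).
   Context: **Pattern avoidance.** Permutations of $\{1,\dots,n\}$ are written as sequences of values. A permutation avoids $4231$ if it has no subsequence of length $4$ whose values are in the same relative order as $4,2,3,1$. $\mathrm{Av}(4231)$ is the set of all permutations (of all lengths, including the empty one) avoiding $4231$. **Insertion encoding.** Let $\pi$ be a permutation of length $n$. For $0\le i\le n$, the $i$-th configuration of $\pi$ is obtained from $\pi$ by replacing each maximal block of consecutive entries that are larger than $i$ by a single symbol $\Diamond$ (a slot), and then, if the resulting word does not end with $\Diamond$, appending one $\Diamond$ at the right end. So the $0$-th configuration is $\Diamond$, the $n$-th is $\pi\,\Diamond$, and there is always a slot at the right hand end. The $i$-th configuration arises from the $(i-1)$-st by inserting the new maximum $i$ into one slot, say the $j$-th from the left, in exactly one of four ways, each with a code letter: $\mathbf{f}_j$ (fill): the slot is replaced by $i$; $\mathbf{l}_j$ (left): the slot is replaced by $i\,\Diamond$; $\mathbf{r}_j$ (right): the slot is replaced by $\Diamond\, i$; $\mathbf{m}_j$ (middle): the slot is replaced by $\Diamond\, i\,\Diamond$. Letters $\mathbf{f}$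 and $\mathbf{r}$ are never used in the rightmost slot. The insertion encoding of $\pi$ is the word of length $n$ formed by these code letters in order $i=1,\dots,n$. For example, $246153$ has encoding $\mathbf{m}_1\mathbf{l}_1\mathbf{m}_2\mathbf{l}_1\mathbf{f}_2\mathbf{f}_1$. $\mathcal{B}_k$ is the set of permutations $\pi$ all of whose configurations contain at most $k$ slots. **Lock sequences.** A lock sequence of length $m\ge 1$ is a sequence $s_1s_2\cdots s_m$ of non-negative integers with $s_1=s_m=0$ such that whenever $s_p>0$, one has $p+s_p\le m$, and $j+s_j\le p+s_p$ for all $j$ with $p\le j<p+s_p$. It represents a configuration with $m$ slots, where $s_p>0$ means that the $s_p$ consecutive slots $p,p+1,\dots,p+s_p-1$ are locked until all slots before the $p$-th have been filled. Slot $j$ is locked in $s$ if $p\le j<p+s_p$ for some $p$; otherwise it is unlocked. **Allowed insertions and their results.** The allowed insertions at a lock sequence $s=s_1\cdots s_t$ are the following, for each unlocked slot $j$. An insertion creates a lock starting at the slot immediately to the right of the inserted element and ending at the penultimate slot, replacing any lock that started at the same slot; no lock is created starting at the leftmost slot, and a lock is removed when its left endpoint becomes the leftmost slot. Explicitly: - $\mathbf{l}_j$ ($1\le j\le t$): if $j\ge2$, replace $s_j$ by $t-j$; if $j=1$, leave $s$ unchanged. - $\mathbf{m}_j$ ($1\le j\le t$): the result is $s_1\cdots s_j\,(t-j)\,s_{j+1}\cdots s_t$, of length $t+1$. - $\mathbf{r}_j$ ($1\le j\le t-1$): replace $s_{j+1}$ by $t-j-1$. - $\mathbf{f}_j$ ($1\le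 j\le t-1$): delete $s_j$ and replace $s_{j+1}$ (now in position $j$ of a sequence of length $t-1$) by $t-1-j$ if $j\ge 2$, and by $0$ if $j=1$. *)

(* Defs.v *)
From HB Require Import structures.
From mathcomp Require Import all_boot.

Set Implicit Arguments.
Unset Strict Implicit.
Unset Printing Implicit Defensive.

(* Permutations of {1, ..., n} are sequences of values in one-line notation. *)
Definition is_permutation (p : seq nat) : bool := perm_eq p (iota 1 (size p)).

Definition order_iso (s t : seq nat) : Prop :=
  size s = size t /\
  forall i j, i < size s -> j < size s ->
    (nth 0 s i < nth 0 s j) = (nth 0 t i < nth 0 t j).

Definition avoids (sigma p : seq nat) : Prop :=
  forall t, subseq t p -> ~ order_iso t sigma.

(* A configuration is a word over values [Some x] and slots [None]. *)
Definition config := seq (option nat).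

Definition slots (c : config) : nat := count_mem None c.

Fixpoint collapse (c : config) : config :=
  match c with
  | None :: ((None :: _) as c') => collapse c'
  | x :: c' => x :: collapse c'
  | [::] => [::]
  end.

Definition close_right (c : config) : config :=
  if last (Some 0) c == None then c else rcons c None.

Definition configuration (i : nat) (p : seq nat) : config :=
  close_right (collapse [seq if x <= i then Some x else None | x <- p]).

Definition in_B (k : nat) (p : seq nat) : Prop :=
  forall i, i <= size p -> slots (configuration i p) <= k.

Inductive kind := Fill | Left | Right | Middle.

Definition nat_of_kind (x : kind) : nat :=
  match x with Fill => 0 | Left => 1 | Right => 2 | Middle => 3 end.

Lemma nat_of_kind_inj : injective nat_of_kind.
Proof. by case; case. Qed.

HB.instance Definition _ := Equality.copy kind (inj_type nat_of_kind_inj).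

(* A code letter together with the 1-based index, from the left, of its slot. *)
Definition code : Type := kind * nat.

Definition replacement (x : kind) (i : nat) : config :=
  match x with
  | Fill => [:: Some i]
  | Left => [:: Some i; None]
  | Right => [:: None; Some i]
  | Middle => [:: None; Some i; None]
  end.

(* [c = c1 ++ None :: c2] singles out the slot; it is the rightmost one when
   [c2] has no slot. *)
Definition inserts (i : nat) (a : code) (c c' : config) : Prop :=
  exists c1 c2 : config,
    [/\ c = c1 ++ None :: c2,
        a.2 = (slots c1).+1,
        c' = c1 ++ replacement a.1 i ++ c2
      & a.1 = Fill \/ a.1 = Right -> 0 < slots c2].

(* The letter inserting the value [i] is the [i]-th one, [nth _ w i.-1]. *)
Definition insertion_encoding (p : seq nat) (w : seq code) : Prop :=
  size w = size p /\
  forall i, 0 < i <= size p ->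
    inserts i (nth (Fill, 0) w i.-1)
      (configuration i.-1 p) (configuration i p).

(* Positions in lock sequences are 1-based: [lock s p] is s_p. *)
Definition lock (s : seq nat) (p : nat) : nat := nth 0 s p.-1.

Definition lock_sequence (s : seq nat) : bool :=
  let m := size s in
  [&& 0 < m, lock s 1 == 0, lock s m == 0 &
      all (fun p => (0 < lock s p) ==>
             (p + lock s p <= m) &&
             all (fun j => j + lock s j <= p + lock s p) (iota p (lock s p)))
          (iota 1 m)].

Definition locked (s : seq nat) (j : nat) : bool :=
  has (fun p => p <= j < p + lock s p) (iota 1 (size s)).

Definition allowed (s : seq nat) (a : code) : bool :=
  let: (x, j) := a in
  ~~ locked s j &&
  match x with
  | Left | Middle => 1 <= j <= size s
  | Fill | Right => 1 <= j <= (size s).-1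
  end.

(* As [nth], [set_nth], [take] and [drop] are 0-based, s_j has index [j.-1]. *)
Definition result (s : seq nat) (a : code) : seq nat :=
  let: (x, j) := a in
  let t := size s in
  match x with
  | Left => if 2 <= j then set_nth 0 s j.-1 (t - j) else s
  | Middle => take j s ++ (t - j) :: drop j s
  | Right => set_nth 0 s j (t - j - 1)
  | Fill => take j.-1 s ++ (if 2 <= j then t - 1 - j else 0) :: drop j.+1 s
  end.

Record finite_automaton (L : eqType) := FiniteAutomaton {
  state : finType;
  alphabet : seq L;
  initial : state;
  accepting : pred state;
  transition : state -> L -> state -> bool;
  transition_alphabet :
    forall s a s', transition s a s' -> a \in alphabet
}.

Fixpoint accepts_from (L : eqType) (A : finite_automaton L) (s : state A)
    (w : seq L) : bool :=
  match w with
  | [::] => accepting s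
  | a :: w' => [exists s' : state A, transition s a s' && accepts_from s' w']
  end.

Definition accepts (L : eqType) (A : finite_automaton L) (w : seq L) : bool :=
  accepts_from (initial A) w.

Record lock_state (k : nat) := LockState {
  lock_state_val :> seq nat;
  lock_stateP : lock_sequence lock_state_val && (size lock_state_val <= k)
}.

HB.instance Definition _ k := [isSub for @lock_state_val k].
HB.instance Definition _ k := [Countable of lock_state k by <:].

Definition lock_state_encode k (s : lock_state k) : k.-bseq 'I_k.+1 :=
  insub_bseq k [seq inord x | x <- s].

Definition lock_state_decode k (b : k.-bseq 'I_k.+1) : option (lock_state k) :=
  insub [seq val x | x <- b].

Lemma lock_state_encodeK k : pcancel (@lock_state_encode k) (@lock_state_decode k).
Proof.
move=> s; rewrite /lock_state_decode /lock_state_encode.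
have /andP[/and4P[_ _ _ /allP hs] sk] := lock_stateP s.
rewrite /insub_bseq insubdK ?unfold_in ?size_map //.
suff -> : [seq val x | x <- [seq (inord x : 'I_k.+1) | x <- s]] = s by rewrite valK.
rewrite -map_comp; apply: map_id_in => x /(nthP 0)[i lti <-] /=.
apply: inordK; rewrite ltnS.
case: (posnP (nth 0 s i)) => [-> // | pos].
have hi : i.+1 \in iota 1 (size s) by rewrite mem_iota add1n ltnS.
move: (hs _ hi); rewrite /lock /= pos => /andP[le_m _].
by apply: leq_trans sk; apply: leq_trans le_m; apply: leq_addl.
Qed.

HB.instance Definition _ k : isFinite (lock_state k) :=
  PCanIsFinite (@lock_state_encodeK k).

Definition codes (k : nat) : seq code :=
  [seq (x, j) | x <- [:: Fill; Left; Right; Middle], j <- iota 1 k].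

(* The target is a state, hence a lock sequence of length at most [k]. *)
Definition lock_transition k (s : lock_state k) (a : code) (s' : lock_state k) :
    bool :=
  allowed s a && (lock_state_val s' == result s a).

Lemma lock_transition_alphabet k (s : lock_state k) a s' :
  lock_transition s a s' -> a \in codes k.
Proof.
case: a => x j /andP[/andP[_ al] _].
have /andP[_ sk] := lock_stateP s.
apply: allpairs_f; first by case: x {al}.
rewrite mem_iota add1n ltnS.
by case: x al => /andP[-> le_j]; apply: leq_trans sk => //;
  apply: leq_trans le_j (leq_pred _).
Qed.

Definition zero_state k (hk : 0 < k) : lock_state k := @LockState k [:: 0] hk.

Definition Aut k (hk : 0 < k) : finite_automaton code := {|
  state := lock_state k;
  alphabet := codes k;
  initial := zero_state hk;
  accepting := pred1 (zero_state hk);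
  transition := @lock_transition k;
  transition_alphabet := @lock_transition_alphabet k
|}.

(* Main.v *)
Require Import Defs.
From HB Require Import structures.
From mathcomp Require Import all_boot zify.

Set Implicit Arguments.
Unset Strict Implicit.
Unset Printing Implicit Defensive.

(** Values are inserted in increasing order, so an occurrence [a b c d] of 4231
    betrays itself when its [c] arrives: at that moment [b] and [d] are present
    and [a] is still hidden in a slot, so [c] enters a slot which lies between
    [b] and a smaller entry [d] while some slot remains to the left of [b].
    Conversely such an insertion is fatal, because every slot that has an entry
    to its right will receive a larger value.  Hence a permutation avoids 4231
    exactly when none of its insertions uses such a slot ([avoids_stepsP]).

    The bad slots of a configuration are recorded by its lock sequence [locks]:
    for a slot that is not the leftmost one, take the entries of the block just
    before it, and count the slots from it up to the last entry that is smaller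
    than one of them.  A slot is locked for this sequence exactly when it is bad
    ([locked_locks]).  The inserted value is larger than every entry present.
    So it dominates the block before the next slot, and the lock at that slot
    becomes as long as possible: every slot except the last is followed by an
    entry.  The other locks do not change when the slot used is unlocked, since
    no lock then covers it and the new value is below no entry.  This is the
    rule [result] ([locks_insert]).

    A run of the automaton therefore amounts to a sequence of insertions into
    unlocked slots that starts at a single slot and ends when one slot is left,
    that is, at a permutation followed by a slot.  Erasing the last inserted
    value gives back the previous configuration ([erase_insert]), so the words
    along the run are the configurations of this permutation ([accepts_fromP]).
    Closure of lock sequences under insertions is a separate verification
    ([result_lock_sequence]). *)

(** * Lock sequences are closed under allowed insertions *)

(** The condition on the last entry and the positivity guards follow from the
    0-based form below: a position with a null entry locks nothing, and the last
    position has no room for a lock. *)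
Lemma lock_sequenceP (s : seq nat) :
  reflect [/\ 0 < size s, nth 0 s 0 = 0 &
             forall p, p < size s -> p + nth 0 s p < size s /\
               forall j, p <= j < p + nth 0 s p ->
                 j + nth 0 s j <= p + nth 0 s p]
          (lock_sequence s).
Proof.
apply: (iffP and4P) => [[s0 /eqP h1 _ /allP hs] | [s0 h1 hs]].
  split=> // p ltp; have: p.+1 \in iota 1 (size s) by rewrite mem_iota; lia.
  move=> /hs /implyP; rewrite /Defs.lock /= => hp.
  case: (posnP (nth 0 s p)) => [-> | /hp /andP[le_m /allP nest]].
    by split=> [|j]; lia.
  split=> [|j hj]; first lia.
  have: j.+1 \in iota p.+1 (nth 0 s p) by rewrite mem_iota; lia.
  by move/nest => /=; lia.
split; rewrite ?/Defs.lock ?h1 //.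
  have [//|lt_m _] := hs (size s).-1; first lia.
  by apply/eqP; lia.
apply/allP => p; rewrite mem_iota => hp; apply/implyP => _.
have /hs[lt_m nest] : p.-1 < size s by lia.
apply/andP; split; first lia.
apply/allP => j; rewrite mem_iota => hj.
have := nest j.-1; lia.
Qed.

Lemma lockedP (s : seq nat) (q : nat) :
  reflect (exists2 p, p <= q < p + nth 0 s p & p < size s) (Defs.locked s q.+1).
Proof.
apply: (iffP hasP) => [[p] | [p hp ltp]].
  by rewrite mem_iota /Defs.lock => hp hq; exists p.-1; lia.
by exists p.+1; rewrite ?mem_iota /Defs.lock /=; lia.
Qed.

(** Locks starting at or before an unlocked slot end before it, so an insertion
    there does not stretch or cut them.  Locks starting later are shifted along
    with their slots, and the new lock ends at the penultimate slot, hence is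
    nested with all of those. *)
Lemma result_lock_sequence (s : seq nat) (a : code) :
  lock_sequence s -> allowed s a -> lock_sequence (result s a).
Proof.
case: a => x [|j]; first by case: x => _ /andP[].
move=> /lock_sequenceP[s0 h1 hs] /andP[/lockedP unl hj].
(* No lock that starts at or before the slot used extends beyond it. *)
have free p : p <= j -> p + nth 0 s p <= j.
  move=> le_pj; rewrite leqNgt; apply/negP => lt_j.
  by apply: unl; exists p; case: (x) hj; lia.
have keep p q : p <= j -> p <= q < p + nth 0 s p -> q + nth 0 s q <= p + nth 0 s p.
  by move=> le_pj hq; have le_p := free _ le_pj; apply: (proj2 (hs p _)) => //;
    case: (x) hj; lia.
have bound q : q < size s -> q + nth 0 s q < size s by case/hs.
have nest p q :
    p < size s -> p <= q < p + nth 0 s p -> q + nth 0 s q <= p + nth 0 s p.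
  by case/hs => _; apply.
apply/lock_sequenceP; case: x hj => /= hj.
- set v := if _ then _ else _.
  have sz : size (take j s ++ v :: drop j.+2 s) = (size s).-1.
    by rewrite size_cat size_takel /= ?size_drop; lia.
  have nthE p : nth 0 (take j s ++ v :: drop j.+2 s) p =
      if p < j then nth 0 s p else if p == j then v else nth 0 s p.+1.
    rewrite nth_cat size_takel; last lia.
    case: ltnP => lt_pj; first by rewrite nth_take.
    have [->|ne] := eqVneq p j; first by rewrite subnn.
    have -> : p - j = (p - j.+1).+1 by lia.
    by rewrite /= nth_drop; congr nth; lia.
  (* After a fill at the leftmost slot, the lock is removed: v = 0. *)
  have le_v : v = 0 \/ j + v = (size s).-2 by rewrite /v; case: ifP; lia.
  rewrite sz; split; first lia.
    by rewrite nthE /v; case: (j).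
  move=> p ltp; split=> [|q]; rewrite !nthE.
    by have := free p; have := bound p.+1; case: (ltngtP p j); lia.
  have := free p; have := free q; have := keep p q; have := bound q.+1.
  have := nest p.+1 q.+1.
  by case: (ltngtP p j); case: (ltngtP q j); lia.
- case: ifP => [j0|_] //.
  have sz : size (set_nth 0 s j (size s - j.+1)) = size s.
    by rewrite size_set_nth; lia.
  rewrite sz; split; first lia.
    by rewrite nth_set_nth /=; case: eqP => //; lia.
  move=> p ltp; split=> [|q]; rewrite !nth_set_nth /=.
    by have := bound p; case: eqP; lia.
  have := free p; have := free q; have := bound q; have := nest p q.
  by case: (eqVneq p j); case: (eqVneq q j); lia.
- have sz : size (set_nth 0 s j.+1 (size s - j.+1 - 1)) = size s.
    by rewrite size_set_nth; lia.
  rewrite sz; split; first lia.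
    by rewrite nth_set_nth.
  move=> p ltp; split=> [|q]; rewrite !nth_set_nth /=.
    by have := bound p; case: eqP; lia.
  have := free p; have := bound q; have := nest p q.
  by case: (eqVneq p j.+1); case: (eqVneq q j.+1); lia.
- set v := size s - j.+1.
  have sz : size (take j.+1 s ++ v :: drop j.+1 s) = (size s).+1.
    by rewrite size_cat size_takel /= ?size_drop; lia.
  have nthE p : nth 0 (take j.+1 s ++ v :: drop j.+1 s) p =
      if p < j.+1 then nth 0 s p else if p == j.+1 then v else nth 0 s p.-1.
    rewrite nth_cat size_takel; last lia.
    case: ltnP => lt_pj; first by rewrite nth_take.
    have [->|ne] := eqVneq p j.+1; first by rewrite subnn.
    have -> : p - j.+1 = (p - j.+2).+1 by lia.
    by rewrite /= nth_drop; congr nth; lia.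
  rewrite sz; split; first lia.
    by rewrite nthE.
  move=> p ltp; split=> [|q]; rewrite !nthE.
    by have := free p; have := bound p.-1; case: (ltngtP p j.+1); lia.
  have := free p; have := free q; have := keep p q; have := bound q.-1.
  have := nest p.-1 q.-1.
  by case: (ltngtP p j.+1); case: (ltngtP q j.+1); lia.
Qed.

(** * Configurations as collapsed words *)

Definition erase (i : nat) (o : option nat) : option nat :=
  if o is Some x then if x <= i then Some x else None else None.

(** The full configuration, from which [erase i] recovers the [i]-th one.  The
    final slot is present from the start: collapsing absorbs it when the word
    already ends with a slot, so no case distinction is needed on the right. *)
Definition word (p : seq nat) : config := rcons (map Some p) None.

(** The step by which [collapse] is a right fold. *)
Definition squash (o : option nat) (c : config) : config :=
  if (o == None) && (head (Some 0) c == None) then c else o :: c.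

Lemma collapse_cons o c : collapse (o :: c) = squash o (collapse c).
Proof.
have hd d : head (Some 0) (collapse d) = head (Some 0) d.
  by elim: d => [|[x|] [|[y|] d] //=].
by rewrite /squash hd; case: o c => [x|] [|[y|] c].
Qed.

Lemma collapse_catr c1 d d' :
  collapse d = collapse d' -> collapse (c1 ++ d) = collapse (c1 ++ d').
Proof. by elim: c1 => // o c1 IH /IH e; rewrite !cat_cons !collapse_cons e. Qed.

Lemma collapse_map_erase i c :
  collapse (map (erase i) (collapse c)) = collapse (map (erase i) c).
Proof.
elim: c => [|o c IH] //; rewrite map_cons (collapse_cons _ (map _ _)) -IH.
rewrite -collapse_cons collapse_cons /squash -map_cons.
by case: o => [x|] //; case: (collapse c) => [|[y|] d].
Qed.

Lemma collapse_subseq c : subseq (collapse c) c.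
Proof.
elim: c => [|o c IH] //; rewrite collapse_cons /squash.
case: ifP => _; last by rewrite /= eqxx.
exact: subseq_trans IH (subseq_cons _ _).
Qed.

Lemma squash_subseq o c d : subseq c d -> subseq (squash o c) (squash o d).
Proof.
have sub_squash e : subseq e (squash o e).
  by rewrite /squash; case: ifP => _ //; apply: subseq_cons.
move=> cd; rewrite {1}/squash; case: ifP => [_ | ].
  exact: subseq_trans cd (sub_squash d).
case: o {sub_squash} => [x|] /= hc; first by rewrite eqxx.
rewrite /squash; case: d cd => [|[y|] d] /=; rewrite ?eqxx //.
by case: c hc => [|[z|] c] //= _; rewrite sub0seq.
Qed.

(** Collapsing cannot destroy a pattern that is itself collapsed: a slot of the
    pattern may be matched with any slot of the same run of slots. *)
Lemma subseq_collapse c d : subseq c d -> subseq (collapse c) (collapse d).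
Proof.
elim: d c => [|o d IH] [|o' c] //; first by move=> _; exact: sub0seq.
rewrite [subseq _ _]/=; case: eqP => [-> /IH | _ /IH sub].
  by rewrite !collapse_cons; apply: squash_subseq.
rewrite (collapse_cons o d) /squash; case: ifP => // _.
exact: subseq_trans sub (subseq_cons _ _).
Qed.

Lemma configurationE i p :
  configuration i p = collapse (map (erase i) (word p)).
Proof.
have close c : close_right (collapse c) = collapse (rcons c None).
  elim: c => [|o c IH] //; rewrite rcons_cons !collapse_cons -IH.
  case: (collapse c) => [|[x|] d]; case: o => [y|] //;
    by rewrite /squash /close_right /=; case: eqP => //= ->.
rewrite /configuration close /word map_rcons -map_comp.
by congr (collapse (rcons _ _)).
Qed.

Lemma configuration_erase i j p : i <= j ->
  configuration i p = collapse (map (erase i) (configuration j p)).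
Proof.
move=> le_ij; rewrite !configurationE collapse_map_erase -map_comp.
congr collapse; apply: eq_map => -[x|] //=.
by case: (leqP x j) => //= lt_jx; rewrite leqNgt (leq_ltn_trans le_ij lt_jx).
Qed.

(** The shape of all configurations: slots are pairwise separated by entries,
    and the word ends with a slot. *)
Fixpoint valid (c : config) : bool :=
  match c with
  | [::] => false
  | [:: None] => true
  | None :: (None :: _) => false
  | _ :: c' => valid c'
  end.

Lemma valid_cons o c :
  valid (o :: c) = if c is o' :: _ then ((o != None) || (o' != None)) && valid c
                   else o == None.
Proof. by case: o c => [x|] [|[y|] c]. Qed.

Lemma collapse_valid c : valid c -> collapse c = c.
Proof.
elim: c => [|o c IH] //; rewrite valid_cons collapse_cons.
case: c IH => [|o' c] IH; first by move=> /eqP->.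
by case/andP=> h /IH ->; rewrite /squash; case: o h {IH} => [x|]; case: o' => [y|].
Qed.

Lemma valid_catr c1 o c2 : valid (c1 ++ o :: c2) -> valid (o :: c2).
Proof.
elim: c1 => [|o' c1 IH] //; rewrite cat_cons valid_cons.
by case: c1 IH => [|? c1] IH /= /andP[_] // /IH.
Qed.

Lemma valid_slots c : valid c -> 0 < slots c.
Proof.
elim: c => [|o c IH] //; rewrite valid_cons.
case: c IH => [|o' c] IH; first by move=> /eqP->.
by case/andP=> _ /IH; rewrite /slots /=; lia.
Qed.

Lemma valid_insert c1 c2 x i :
  valid (c1 ++ None :: c2) -> (x = Fill \/ x = Right -> 0 < slots c2) ->
  valid (c1 ++ replacement x i ++ c2).
Proof.
move=> v2 hx; elim: c1 v2 => [|o c1 IH].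
  case: c2 hx => [|[y|] c2] // hx; last by case: x {hx}.
  by case: x hx => // hx; suff: 0 < slots [::] by []; apply: hx; auto.
rewrite !cat_cons !valid_cons.
case: c1 IH => [|o' c1] IH; last by rewrite !cat_cons /= => /andP[-> /IH].
rewrite !cat0s in IH *; case/andP=> ho /IH.
by case: x {IH hx} => /= ->; case: o ho.
Qed.

Definition entries (c : config) : seq nat := pmap id c.

Lemma entries_word p : entries (word p) = p.
Proof. by rewrite /entries /word -cats1 pmap_cat cats0; elim: p => //= x p ->. Qed.

Lemma mem_entries x c : (x \in entries c) = (Some x \in c).
Proof. by elim: c => [|[y|] c IH] //; rewrite ?inE -IH //. Qed.

Lemma entries_insert c1 c2 x i :
  perm_eq (entries (c1 ++ replacement x i ++ c2))
          (rcons (entries (c1 ++ None :: c2)) i).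
Proof.
rewrite /entries !pmap_cat -cats1 -catA perm_cat2l.
have -> : pmap id (replacement x i) = [:: i] by case: x.
by rewrite perm_catC.
Qed.

(** Undoing an insertion: once [i.+1] is erased, each of the four replacements
    is a run of slots, which collapses to the slot it came from. *)
Lemma erase_insert c1 c2 x i :
  (forall y, y \in entries (c1 ++ None :: c2) -> y <= i) ->
  collapse (map (erase i) (c1 ++ replacement x i.+1 ++ c2)) =
  collapse (c1 ++ None :: c2).
Proof.
move=> le_i.
have hid c : {subset c <= c1 ++ None :: c2} -> map (erase i) c = c.
  move=> sub; rewrite -[RHS]map_id; apply/eq_in_map => -[y|] // /sub.
  by rewrite -mem_entries => /le_i /= ->.
have hid1 : map (erase i) c1 = c1 by apply: hid => o o1; rewrite mem_cat o1.
have hid2 : map (erase i) c2 = c2.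
  by apply: hid => o o2; rewrite mem_cat inE o2 !orbT.
by rewrite !map_cat hid1 hid2; apply: collapse_catr; case: x; rewrite /= ltnn.
Qed.

Lemma slots_split c q : q < slots c ->
  exists c1 c2, c = c1 ++ None :: c2 /\ slots c1 = q.
Proof.
elim: c q => [|[x|] c IH] // q.
  by move=> /IH [c1 [c2 [-> <-]]]; exists (Some x :: c1), c2.
case: q => [|q] h; first by exists [::], c.
by have /IH [c1 [c2 [-> <-]]] : q < slots c by []; exists (None :: c1), c2.
Qed.

Lemma valid_one_slot c : valid c -> slots c = 1 -> c = word (entries c).
Proof.
elim: c => [|o c IH] //; rewrite valid_cons.
case: c IH => [|o' c] IH; first by move=> /eqP->.
case/andP=> _ v; case: o => [x|] h; first by rewrite {1}IH.
by have := valid_slots v; move: h; rewrite /slots /=; lia.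
Qed.

(** * The lock sequence of a configuration *)

Definition below (m : nat) (c : config) : bool := has (gtn m) (entries c).

(** The number of slots of [c] that lie before the last entry smaller than [m]:
    the length of the lock caused by a block with maximum [m] that is followed
    by [c]. *)
Fixpoint reach (m : nat) (c : config) : nat :=
  match c with
  | [::] => 0
  | Some _ :: c' => reach m c'
  | None :: c' => if below m c' then (reach m c').+1 else 0
  end.

(** Reading from left to right, [b] tells whether a slot has been met, and [m]
    is the largest entry since the last slot.  In a block, only the maximum
    matters, as it has the most smaller entries to its right; 0 stands for the
    empty block, because no entry is smaller than it. *)
Fixpoint locks_from (b : bool) (m : nat) (c : config) : seq nat :=
  match c with
  | [::] => [::]
  | Some x :: c' => locks_from b (maxn m x) c'
  | None :: c' => (if b then reach m c else 0) :: locks_from true 0 c'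
  end.

Definition locks (c : config) : seq nat := locks_from false 0 c.

(** The state [m] of [locks_from] after reading [c]. *)
Fixpoint top (m : nat) (c : config) : nat :=
  match c with
  | [::] => m
  | Some x :: c' => top (maxn m x) c'
  | None :: c' => top 0 c'
  end.

(** No lock starting at a slot of [c1] extends past [c1] into [c2]; the
    arguments [b] and [m] are the state of [locks_from]. *)
Fixpoint clear (b : bool) (m : nat) (c1 c2 : config) : bool :=
  match c1 with
  | [::] => true
  | Some x :: c' => clear b (maxn m x) c' c2
  | None :: c' => (b ==> ~~ below m c2) && clear true 0 c' c2
  end.

Lemma size_locks_from b m c : size (locks_from b m c) = slots c.
Proof. by elim: c b m => [|[x|] c IH] b m //=; rewrite IH. Qed.

Lemma behead_locks_from b m b' m' c :
  behead (locks_from b m c) = behead (locks_from b' m' c).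
Proof. by elim: c b m b' m' => [|[x|] c IH] b m b' m' //=; apply: IH. Qed.

Lemma below_cat m c d : below m (c ++ d) = below m c || below m d.
Proof. by rewrite /below /entries pmap_cat has_cat. Qed.

Lemma reach_catr m c d : ~~ below m d -> reach m (c ++ d) = reach m c.
Proof.
move=> nb; elim: c => [|[x|] c IH] //=; last first.
  by rewrite below_cat (negbTE nb) orbF IH.
elim: d nb => [|[x|] d IH] //=; rewrite /below /=.
  by rewrite negb_or => /andP[_] /IH.
by move/negbTE->.
Qed.

(** In a configuration every slot but the last is followed by an entry, here
    smaller than [m]. *)
Lemma reach_full m c :
  valid c -> all (gtn m) (entries c) -> reach m c = (slots c).-1.
Proof.
elim: c => [|o c IH] //; rewrite valid_cons.
case: c IH => [|o' c] IH; first by move=> /eqP->.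
case/andP=> ho v; case: o ho => [x|] ho le.
  by case/andP: le => _ le; exact: IH v le.
case: o' ho IH v le => // y _ IH v le.
have lt_y : y < m by case/andP: le.
rewrite -[LHS]/(if below m (Some y :: c) then (reach m (Some y :: c)).+1 else 0).
have -> : below m (Some y :: c) by rewrite /below /= lt_y.
by rewrite IH //; have := valid_slots v; rewrite /slots /=; lia.
Qed.

(** What comes before [c] influences only the first lock of [c], which is as
    long as possible when [m] exceeds all entries of [c]. *)
Lemma locks_from_full b m c :
  valid c -> all (gtn m) (entries c) ->
  locks_from b m c =
  (if b then (slots c).-1 else 0) :: behead (locks_from true 0 c).
Proof.
move=> v le; have full := reach_full v le; have pos := valid_slots v.
elim: c b v le full pos => [|[x|] c IH] b // v le full pos.
  case/andP: le => lt_x le; rewrite [LHS]/= (maxn_idPl (ltnW lt_x)).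
  rewrite [locks_from true 0 (_ :: _)]/= (behead_locks_from true _ true 0).
  have vc : valid c by case: (c) v pos.
  exact: IH b vc le full pos.
by rewrite -full.
Qed.

(** Locks that do not extend past [c1] can be computed from [c1] alone. *)
Lemma locks_from_cat b m c1 d : clear b m c1 d ->
  locks_from b m (c1 ++ d) =
  locks_from b m c1 ++ locks_from (b || (0 < slots c1)) (top m c1) d.
Proof.
elim: c1 b m => [|[x|] c1 IH] b m /=; first by rewrite orbF.
  by move/IH->.
case/andP=> nb /IH ->; rewrite orbT /=; case: b nb => //= nb.
by rewrite below_cat (negbTE nb) orbF reach_catr.
Qed.

Lemma clear_rcons b m c1 c2 :
  clear b m (rcons c1 None) c2 =
  clear b m c1 c2 && ((b || (0 < slots c1)) ==> ~~ below (top m c1) c2).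
Proof.
elim: c1 b m => [|[x|] c1 IH] b m /=; first by rewrite andbT orbF.
  by rewrite IH.
by rewrite IH andbA orbT.
Qed.

Lemma top_le i m c : m <= i -> all (geq i) (entries c) -> top m c <= i.
Proof.
elim: c m => [|[x|] c IH] m //= le_m; last exact: IH.
by case/andP=> le_x; apply: IH; rewrite geq_max le_m.
Qed.

Lemma eq_clear i b m c1 c2 c2' :
  (forall m', m' <= i -> below m' c2 = below m' c2') ->
  m <= i -> all (geq i) (entries c1) ->
  clear b m c1 c2 = clear b m c1 c2'.
Proof.
move=> eq_below; elim: c1 b m => [|[y|] c1 IH] b m //= le_m.
  by case/andP=> le_y; apply: IH; rewrite geq_max le_m.
by move=> le; rewrite IH // eq_below.
Qed.

Lemma set_nth_size (s1 s2 : seq nat) u v :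
  set_nth 0 (s1 ++ u :: s2) (size s1) v = s1 ++ v :: s2.
Proof. by elim: s1 => //= y s1 ->. Qed.

(** Since the slot is unlocked, the locks of [c1] are the same before and after
    the insertion, and the slot carries no lock of its own.  The new value [i]
    is the maximum of its block, so by [locks_from_full] the next slot receives
    a lock that reaches the penultimate slot. *)
Lemma locks_insert i x c1 c2 :
  valid (c1 ++ None :: c2) -> all (gtn i) (entries (c1 ++ None :: c2)) ->
  clear false 0 (rcons c1 None) c2 ->
  (x = Fill \/ x = Right -> 0 < slots c2) ->
  locks (c1 ++ replacement x i ++ c2) =
  result (locks (c1 ++ None :: c2)) (x, (slots c1).+1).
Proof.
rewrite clear_rcons /= => v; rewrite /entries pmap_cat all_cat => /andP[lt1 lt2].
case/andP=> cl1 clt hx.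
have le1 : all (geq i) (entries c1).
  by apply: sub_all lt1 => y /=; apply: ltnW.
have v2 := valid_catr v.
have v2' : 0 < slots c2 -> valid c2 by case: (c2) v2 => [|[y|] d].
have cl1' : clear false 0 c1 (None :: c2) by rewrite (@eq_clear i _ _ _ _ c2).
have cl1'' : clear false 0 c1 (replacement x i ++ c2).
  rewrite (@eq_clear i _ _ _ _ c2) // => m' le_m'; rewrite below_cat.
  by case: (x); rewrite /below /= orbF ltnNge le_m'.
rewrite /locks (locks_from_cat cl1') (locks_from_cat cl1'') orFb.
set s1 := locks_from false 0 c1; set b := 0 < slots c1 in clt *.
set m := top 0 c1 in clt *.
have le_m : m <= i by apply: top_le.
have sz1 : size s1 = slots c1 by rewrite size_locks_from.
have e0 : (if b then reach m (None :: c2) else 0) = 0.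
  by case: b clt => //= /negbTE ->.
rewrite [locks_from b m (None :: c2)]/= -/(reach m (None :: c2)) e0.
have sz : size (s1 ++ 0 :: locks_from true 0 c2) = slots c1 + (slots c2).+1.
  by rewrite size_cat /= size_locks_from sz1.
have full_l b' : locks_from b' i (None :: c2) =
    (if b' then slots c2 else 0) :: locks_from true 0 c2.
  by rewrite locks_from_full.
have full_r b' : 0 < slots c2 -> locks_from b' i c2 =
    (if b' then (slots c2).-1 else 0) :: behead (locks_from true 0 c2).
  by move/v2' => vc; rewrite locks_from_full.
rewrite /result sz.
case: x {cl1''} hx => hx; rewrite [replacement _ _]/= ?cat_cons cat0s.
- have pos : 0 < slots c2 by apply: hx; left.
  rewrite [locks_from b m _]/= (maxn_idPr le_m) full_r // -sz1.
  have -> : drop (size s1).+2 (s1 ++ 0 :: locks_from true 0 c2) =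
      behead (locks_from true 0 c2).
    by rewrite -(addn2 (size s1)) addnC -drop_drop drop_size_cat //= drop1.
  rewrite take_size_cat //; congr (_ ++ _ :: _).
  by rewrite /b -sz1 ltnS; case: ifP => _ //; lia.
- rewrite [locks_from b m _]/= (maxn_idPr le_m) -/(locks_from b i (None :: c2)).
  rewrite full_l /b ltnS -sz1; case: ifP => // _.
  by rewrite set_nth_size; congr (_ ++ _ :: _); lia.
- have pos : 0 < slots c2 by apply: hx; right.
  rewrite -[locks_from b m _]/((if b then reach m (None :: Some i :: c2) else 0)
    :: locks_from true (maxn 0 i) c2) max0n full_r // -cat_rcons.
  have -> : (if b then reach m (None :: Some i :: c2) else 0) = 0.
    case: (b) clt => //= /negbTE nb; rewrite /below /= ltnNge le_m /=.
    by rewrite -/(below m c2) nb.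
  rewrite -[in RHS]cat_rcons.
  have -> : slots c1 + (slots c2).+1 - (slots c1).+1 - 1 = (slots c2).-1 by lia.
  case: (locks_from true 0 c2) (size_locks_from true 0 c2) => [|u d] /= szd.
    by rewrite -szd in pos.
  have -> : (slots c1).+1 = size (rcons s1 0) by rewrite size_rcons sz1.
  by rewrite set_nth_size.
- rewrite -[locks_from b m _]/(
    (if b then reach m (None :: Some i :: None :: c2) else 0)
      :: locks_from true (maxn 0 i) (None :: c2)) max0n full_l.
  have -> : (if b then reach m (None :: Some i :: None :: c2) else 0) = 0.
    case: (b) clt => //= /negbTE nb; rewrite /below /= ltnNge le_m /=.
    by rewrite -/(below m c2) nb.
  have -> : (slots c1).+1 = size (rcons s1 0) by rewrite size_rcons sz1.
  rewrite -!cat_rcons take_size_cat // drop_size_cat // !cat_rcons.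
  by congr (_ ++ _ :: _ :: _); rewrite size_rcons sz1; lia.
Qed.

Lemma locked_cons v s q :
  Defs.locked (v :: s) q.+1 = (q < v) || ((0 < q) && Defs.locked s q).
Proof.
apply/lockedP/orP => [[[|p] /= hp ltp] | [lt_v | ]]; first by left; lia.
- right; case: q hp => [|q] hp //=; apply/lockedP; exists p => //; lia.
- by exists 0 => //=; lia.
- by case: q => // q /lockedP[p hp ltp]; exists p.+1 => /=; lia.
Qed.

(** The lock of a block covers the slot singled out exactly when some smaller
    entry lies beyond that slot. *)
Lemma slots_lt_reach m c1 c2 :
  (slots c1 < reach m (c1 ++ None :: c2)) = below m c2.
Proof.
elim: c1 => [|[x|] c1 IH] //=; first by case: ifP.
by rewrite below_cat -IH; case: ifP => //; rewrite IH => /norP[_ /negbTE].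
Qed.

Lemma locked_locks_from b m c1 c2 :
  Defs.locked (locks_from b m (c1 ++ None :: c2)) (slots c1).+1 =
  ~~ clear b m (rcons c1 None) c2.
Proof.
elim: c1 b m => [|[x|] c1 IH] b m; last 2 first.
- exact: IH.
- rewrite -[LHS]/(Defs.locked (
    (if b then reach m ((None :: c1) ++ None :: c2) else 0)
      :: locks_from true 0 (c1 ++ None :: c2)) (slots (None :: c1)).+1).
  rewrite locked_cons IH /= negb_and.
  by case: b => //=; rewrite (slots_lt_reach m (None :: c1)) negbK.
rewrite -[LHS]/(Defs.locked ((if b then reach m ([::] ++ None :: c2) else 0)
  :: locks_from true 0 c2) (slots [::]).+1).
rewrite locked_cons /= andbT orbF.
by case: b => //=; rewrite (slots_lt_reach m [::]) negbK.
Qed.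

(** The generalization of [locked_locks] to an arbitrary state of [locks_from]:
    once a slot has been met, the larger entry can also be the maximum [m] of
    the block being read, or any entry of [c1]. *)
Lemma not_clearP b m c1 c2 :
  ~~ clear b m (rcons c1 None) c2 <->
  exists2 y, Some y \in c2 &
    b && (y < m) \/
    exists2 x, y < x & b && (Some x \in c1) || subseq [:: None; Some x] c1.
Proof.
have belowP m' : reflect (exists2 y, Some y \in c2 & y < m') (below m' c2).
  by apply: (iffP hasP) => -[y y2 lt_y]; exists y => //; move: y2;
    rewrite mem_entries.
elim: c1 b m => [|[z|] c1 IH] b m.
- rewrite /= andbT; split.
    by case: b => //=; rewrite negbK => /belowP[y]; exists y => //; left.
  case=> y y2 [/andP[-> lt_y] | [x _]]; last by rewrite andbF.
  by rewrite /= negbK; apply/belowP; exists y.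
- apply: (iff_trans (IH _ _)); split=> -[y y2 hy]; exists y => //.
    case: hy => [/andP[bT] | [x lt_yx hx]]; last first.
      right; exists x => //; rewrite inE /=.
      by case/orP: hx => [/andP[-> ->]|->]; rewrite !orbT.
    rewrite leq_max => /orP[]; first by left; rewrite bT.
    by right; exists z => //; rewrite bT inE eqxx.
  case: hy => [/andP[-> lt_y] | [x lt_yx]]; first by left; rewrite leq_max lt_y.
  rewrite inE /=; case/orP=> [/andP[bT /orP[/eqP[e]|x1]] | sub].
  + by left; rewrite bT leq_max -e lt_yx orbT.
  + by right; exists x => //; rewrite bT x1.
  + by right; exists x => //; rewrite sub orbT.
rewrite rcons_cons /= negb_and; split.
  case/orP => [|/IH[y y2 [//|[x lt_yx]]]].
    by case: b => //=; rewrite negbK => /belowP[y]; exists y => //; left.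
  move=> h; exists y => //; right; exists x => //.
  rewrite /= sub1seq; have [|nx] := boolP (Some x \in c1); first by rewrite orbT.
  case/orP: h => [/= x1 | /mem_subseq /(_ (Some x))]; first by rewrite x1 in nx.
  by rewrite !inE eqxx orbT (negbTE nx) => /(_ isT).
case=> y y2 [/andP[-> lt_y] | [x lt_yx]].
  by rewrite /= negbK; apply/orP; left; apply/belowP; exists y.
move=> h; apply/orP; right; apply/IH; exists y => //; right; exists x => //.
by move: h; rewrite inE /= sub1seq => /orP[/andP[_ ->]|->].
Qed.

(** A slot is locked exactly when inserting into it would complete a pattern
    made of a slot, the entry [x], the new value and the entry [y < x]. *)
Lemma locked_locks c1 c2 :
  Defs.locked (locks (c1 ++ None :: c2)) (slots c1).+1 <->
  exists x y, [/\ subseq [:: None; Some x] c1, Some y \in c2 & y < x].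
Proof.
rewrite /locks locked_locks_from not_clearP /=.
by split=> [[y y2 [|[x lt_yx sub]]] // | [x [y [sub y2 lt_yx]]]];
  [exists x, y | exists y => //; right; exists x].
Qed.

(** * Runs of the automaton *)

Definition good_step (k i : nat) (p : seq nat) (a : code) : Prop :=
  [/\ inserts i.+1 a (configuration i p) (configuration i.+1 p),
      slots (configuration i.+1 p) <= k
    & ~~ Defs.locked (locks (configuration i p)) a.2].

Lemma slots_insert c1 c2 : slots (c1 ++ None :: c2) = slots c1 + (slots c2).+1.
Proof. by rewrite /slots count_cat. Qed.

Lemma allowedP s a :
  allowed s a <->
  [/\ ~~ Defs.locked s a.2, 0 < a.2 <= size s
    & a.1 = Fill \/ a.1 = Right -> a.2 < size s].
Proof.
case: a => x j /=; split=> [/andP[-> hj] | [-> hj hx]].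
  by split=> //; [case: (x) hj | case=> ex; rewrite ex in hj]; lia.
case: x hx => hx //=; first by have := hx (or_introl erefl); lia.
by have := hx (or_intror erefl); lia.
Qed.

Lemma inserts_step i a c c' :
  valid c -> perm_eq (entries c) (iota 1 i) -> inserts i.+1 a c c' ->
  [/\ valid c', perm_eq (entries c') (iota 1 i.+1),
      collapse (map (erase i) c') = c
    & ~~ Defs.locked (locks c) a.2 ->
      allowed (locks c) a /\ locks c' = result (locks c) a].
Proof.
case: a => x j v pc [c1 [c2 [ec ej ec' hx]]]; rewrite /= in ej ec' hx; subst c c' j.
have mem y : y \in entries (c1 ++ None :: c2) -> y <= i.
  by rewrite (perm_mem pc) mem_iota; lia.
split.
- exact: valid_insert.
- apply: perm_trans (entries_insert _ _ _ _) _.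
  by rewrite -[X in iota 1 X]addn1 iotaD add1n -cats1 perm_cat2r.
- by rewrite erase_insert // collapse_valid.
- move=> unl; split; last first.
    apply: locks_insert => //; first by apply/allP => y /mem /=.
    by move: unl; rewrite locked_locks_from negbK.
  apply/allowedP; rewrite size_locks_from slots_insert /=.
  by split=> [//|{hx}|/hx {hx}]; lia.
Qed.

(** Reading [w] from the lock sequence of a configuration [c] with [i] entries.
    In one direction the permutation is found at the end of the run, and the
    earlier configurations by erasing its largest values; in the other one the
    configurations of the permutation dictate the run. *)
Lemma accepts_fromP k (hk : 0 < k) w i (s : lock_state k) c :
  valid c -> perm_eq (entries c) (iota 1 i) -> lock_state_val s = locks c ->
  @accepts_from _ (Aut hk) s w <->
  exists p, [/\ is_permutation p, size p = i + size w, configuration i p = c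
    & forall j, j < size w -> good_step k (i + j) p (nth (Fill, 0) w j)].
Proof.
elim: w i s c => [|a w IH] i s c v pc es.
  split=> [/eqP se | [p [pp sp ec _]]].
    have one : slots c = 1 by rewrite -(size_locks_from false 0) -/(locks c) -es se.
    have cE := valid_one_slot v one.
    have sz : size (entries c) = i by rewrite (perm_size pc) size_iota.
    exists (entries c); split=> //; rewrite ?addn0 //.
      by rewrite /is_permutation sz.
    rewrite configurationE -cE (_ : map _ c = c) ?collapse_valid //.
    rewrite -[RHS]map_id; apply/eq_in_map => -[x|] //.
    by rewrite -mem_entries (perm_mem pc) mem_iota /= => h; rewrite ifT //; lia.
  apply/eqP/val_inj; rewrite /= es -ec configurationE.
  rewrite addn0 in sp.
  have -> : map (erase i) (word p) = word p.
    rewrite -[RHS]map_id; apply/eq_in_map => -[x|] //.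
    rewrite -mem_entries entries_word (perm_mem pp) mem_iota sp /= => h.
    by rewrite ifT //; lia.
  rewrite collapse_valid; last by elim: (p).
  suff locks1 m : locks_from false m (word p) = [:: 0] by exact: locks1.
  by elim: (p) m => //= x q IHq m; exact: IHq.
split=> [/existsP[s' /andP[/andP[al /eqP es']] acc] | [p [pp sp ec steps]]].
  have /allowedP[unl hj hx] := al.
  rewrite es size_locks_from in unl hj hx.
  have [c1 [c2 [ec ej]]] : exists c1 c2, c = c1 ++ None :: c2 /\ slots c1 = a.2.-1.
    by apply: slots_split; case/andP: hj => j0; rewrite prednK.
  have ins : inserts i.+1 a c (c1 ++ replacement a.1 i.+1 ++ c2).
    have j_eq : a.2 = (slots c1).+1 by rewrite ej prednK //; case/andP: hj.
    by exists c1, c2; split=> // /hx {hx}; rewrite j_eq ec slots_insert; lia.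
  have [v' pc' hid loc] := inserts_step v pc ins.
  have [_ el] := loc unl.
  have es2 : lock_state_val s' = locks (c1 ++ replacement a.1 i.+1 ++ c2).
    by rewrite el es' es.
  have [p [pp sp ep steps]] := (IH _ _ _ v' pc' es2).1 acc.
  have e0 : configuration i p = c.
    by rewrite (configuration_erase p (leqnSn i)) ep.
  exists p; split=> //; first by rewrite sp addSnnS.
  case=> [|j] ltj; last by rewrite addnS -addSn; exact: steps.
  rewrite addn0; split; rewrite ?e0 ?ep //.
  by have /andP[_] := lock_stateP s'; rewrite es2 size_locks_from.
have := steps 0 isT; rewrite addn0 /good_step ec => -[ins le_k unl].
have [v' pc' _ /(_ unl) [al el]] := inserts_step v pc ins.
rewrite -es in al el.
have ls' : lock_sequence (result s a) && (size (result s a) <= k).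
  rewrite -{2}el size_locks_from le_k andbT.
  by apply: result_lock_sequence => //; have /andP[] := lock_stateP s.
apply/existsP; exists (LockState ls'); apply/andP; split.
  by rewrite /= /lock_transition al eqxx.
apply/(IH i.+1 _ _ v' pc'); first by rewrite /= el.
exists p; split=> //; first by rewrite sp addSnnS.
by move=> j ltj; rewrite addSnnS; exact: (steps j.+1).
Qed.

(** * Occurrences of 4231 in configurations *)

Lemma subseq_rcons_neq (T : eqType) (x y : T) s t :
  x != y -> subseq (rcons s x) (rcons t y) = subseq (rcons s x) t.
Proof.
move=> nxy; rewrite -subseq_rev (rev_rcons t) rev_rcons /=.
by rewrite (negbTE nxy) -rev_rcons subseq_rev.
Qed.

Lemma avoids_4231P p :
  avoids [:: 4; 2; 3; 1] p <->
  ~ exists a b c d, subseq [:: a; b; c; d] p /\ [&& d < b, b < c & c < a].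
Proof.
split=> [av [a [b [c [d [sub /and3P[db bc ca]]]]]] | av t sub [st iso]].
  apply: (av _ sub); split=> // -[|[|[|[|i]]]] [|[|[|[|j]]]] //= _ _; lia.
case: t sub st iso => [|a [|b [|c [|d [|]]]]] // sub _ iso; apply: av.
exists a, b, c, d; split=> //.
by rewrite (iso 3 1) // (iso 1 2) // (iso 2 0).
Qed.

(** The values up to [i] stay visible, while [a] becomes part of a slot. *)
Lemma subseq_configuration i p a b c d :
  b <= i -> c <= i -> d <= i -> i < a ->
  subseq [:: a; b; c; d] p ->
  subseq [:: None; Some b; Some c; Some d] (configuration i p).
Proof.
move=> bi ci di ia sub; rewrite configurationE.
have sub' : subseq (map (erase i) (map Some [:: a; b; c; d]))
                   (map (erase i) (word p)).
  apply: map_subseq; apply: subseq_trans (subseq_rcons _ _).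
  exact: map_subseq.
by move/subseq_collapse: sub'; rewrite /= bi ci di leqNgt ia.
Qed.

Lemma configuration_subseq i p b c d :
  subseq [:: None; Some b; Some c; Some d] (configuration i p) ->
  exists2 a, i < a & subseq [:: a; b; c; d] p.
Proof.
rewrite configurationE => /subseq_trans /(_ (collapse_subseq _)).
rewrite /word map_rcons.
rewrite -[X in subseq X _]/(rcons [:: None; Some b; Some c] (Some d)).
rewrite subseq_rcons_neq //= -map_comp => /subseqP[m _].
rewrite -map_mask.
have := mask_subseq m p; case: (mask m p) => [|a [|b' [|c' [|d' [|]]]]] //= sub.
case; case: leqP => // ia _; do 3 case: ifP => // _ [->].
by exists a.
Qed.

Lemma configuration_le i p x : Some x \in configuration i p -> x <= i.
Proof.
rewrite configurationE => /(mem_subseq (collapse_subseq _)) /mapP[[y|] _] //=.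
by case: ifP => // le_y [->].
Qed.

(** A letter that occurs once can be matched in one way only. *)
Lemma subseq_split_uniq (T : eqType) (z : T) u t s1 s2 :
  z \notin s1 -> z \notin s2 -> subseq (u ++ z :: t) (s1 ++ z :: s2) ->
  subseq u s1 /\ subseq t s2.
Proof.
have absurd v : z \notin s2 -> subseq (v ++ z :: t) s2 -> False.
  move=> n2 /mem_subseq /(_ z); rewrite mem_cat inE eqxx orbT => /(_ isT) z2.
  by rewrite z2 in n2.
move=> + n2; elim: s1 u => [|y s1 IH] [|y' u] /=.
- by rewrite eqxx.
- by case: eqP => _ _; [move/(absurd u n2) | move/(absurd (y' :: u) n2)].
- rewrite inE negb_or => /andP[/negbTE nzy n1]; rewrite nzy => /(IH [::] n1)[_ ?].
  by split=> //; exact: sub0seq.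
- rewrite inE negb_or => /andP[_ n1]; case: eqP => _; first exact: IH.
  exact: (IH (y' :: u)).
Qed.

(** An occurrence [a b c d] of 4231 makes the insertion of [c] use a locked
    slot, and an insertion into a locked slot leaves an occurrence in which the
    inserted value plays the 3. *)
Lemma avoids_stepsP p w :
  is_permutation p -> insertion_encoding p w ->
  avoids [:: 4; 2; 3; 1] p <->
  forall j, j < size w ->
    ~~ Defs.locked (locks (configuration j p)) (nth (Fill, 0) w j).2.
Proof.
move=> pp [sw ins]; rewrite avoids_4231P; split=> [av j ltj | free].
  apply/negP; have [|c1 [c2 [/= ec -> ec' _]]] := ins j.+1; first by rewrite -sw.
  rewrite ec => /locked_locks[x [y [sub y2 lt_yx]]]; apply: av.
  have le_x : x <= j.
    apply: (@configuration_le _ p); rewrite ec mem_cat.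
    by rewrite (mem_subseq sub) // !inE eqxx.
  have : subseq [:: None; Some x; Some j.+1; Some y] (configuration j.+1 p).
    rewrite ec' -[X in subseq X _]/(
      [:: None; Some x] ++ [:: Some j.+1] ++ [:: Some y]).
    apply: cat_subseq => //; apply: cat_subseq; rewrite sub1seq //.
    by case: (nth _ w j).1; rewrite !inE eqxx.
  move=> /configuration_subseq[a lt_a sub4]; exists a, x, j.+1, y.
  by rewrite lt_yx ltnS le_x.
case=> a [b [c [d [sub /and3P[db bc ca]]]]].
have : c \in p by move/mem_subseq: sub; apply; rewrite !inE eqxx !orbT.
rewrite (perm_mem pp) mem_iota add1n ltnS => hc.
have [c1 [c2 [ec ej ec' _]]] := ins _ hc.
have ltc : c.-1 < size w by rewrite sw; lia.
have := free _ ltc; rewrite ej ec => /negP; apply; apply/locked_locks.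
have new : Some c \notin configuration c.-1 p.
  by apply/negP => /configuration_le; lia.
have le_dc := ltnW (ltn_trans db bc).
have sub4 := subseq_configuration (ltnW bc) (leqnn c) le_dc ca sub.
rewrite ec mem_cat inE negb_or /= in new; case/andP: new => new1 new2.
(* The new entry has at most one fresh slot on each side of it. *)
have [l [r [er l0 r0]]] : exists l r : config,
    [/\ replacement (nth (Fill, 0) w c.-1).1 c = l ++ Some c :: r,
        l = [::] \/ l = [:: None] & r = [::] \/ r = [:: None]].
  case: (nth _ w _).1; [exists [::], [::] | exists [::], [:: None]
    | exists [:: None], [::] | exists [:: None], [:: None]]; split; by auto.
rewrite ec' er -catA cat_cons catA in sub4.
have [||sub1 sub2] := subseq_split_uniq (u := [:: None; Some b]) _ _ sub4.
- by rewrite mem_cat negb_or new1; case: l0 => ->.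
- by rewrite mem_cat negb_or new2; case: r0 => ->.
exists b, d; split=> //.
  case: l0 sub1 => ->; rewrite ?cats0 // cats1.
  by rewrite -[X in subseq X _]/(rcons [:: None] (Some b)) subseq_rcons_neq.
by move: sub2; rewrite sub1seq mem_cat; case: r0 => ->.
Qed.

Theorem theorem3 (k : nat) (hk : 0 < k) :
  (forall (s : seq nat) (a : code),
     lock_sequence s -> allowed s a -> lock_sequence (result s a)) /\
  (forall w : seq code,
     accepts (Aut hk) w <->
     exists p : seq nat,
       [/\ is_permutation p,
           in_B k p,
           avoids [:: 4; 2; 3; 1] p
         & insertion_encoding p w]).
Proof.
split=> [|w]; first exact: result_lock_sequence.
have conf0 p : is_permutation p -> configuration 0 p = [:: None].
  move=> pp; rewrite configurationE.
  have : all (leq 1) p.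
    by apply/allP => x; rewrite (perm_mem pp) mem_iota => /andP[].
  elim: p {pp} => [|x p IH] // /andP[x1 /IH e].
  rewrite -[word _]/(Some x :: word p) map_cons collapse_cons e /=.
  by rewrite leqNgt x1.
apply: (iff_trans (@accepts_fromP k hk w 0 (zero_state hk) [:: None] _ _ _)) => //.
split=> [[p [pp sp _ steps]] | [p [pp inB av enc]]].
  rewrite add0n in sp.
  have enc : insertion_encoding p w.
    split=> // -[|i] // hi; have [] := steps i; first by rewrite -sp.
    by rewrite add0n.
  exists p; split=> //; last first.
    by apply/(avoids_stepsP pp enc) => j /steps [].
  case=> [|i] hi; first by rewrite conf0.
  by have [] := steps i; rewrite -?sp.
have free := (avoids_stepsP pp enc).1 av.
have [sw ins] := enc.
exists p; split; rewrite ?conf0 // => j ltj; rewrite add0n; split.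
- by apply: (ins j.+1); rewrite -sw.
- by apply: inB; rewrite -sw.
- exact: free.
Qed.
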